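(* Let $n\ge 1$, $\nu\ge 0$, $\mu_u\ge 0$, $\mu_e\ge 0$ be integers, let $\alpha\in\mathbb R$, and let $g_0,\dots,g_\nu$, $q^u_0,\dots,q^u_{\mu_u}$, $q^e_0,\dots,q^e_{\mu_e}$ be real numbers with $\sum_{i=0}^{\mu_u}q^u_i=1$ and $\sum_{i=0}^{\mu_e}q^e_i=1$. With the matrices $\mathbf G^-$, $\mathbf Q_u$, $\mathbf Q_e$, $\mathbf N$ built from these data as in the context, the $n\times n$ matrix $$\mathbf A=\mathbf Q_u-\alpha\,\mathbf N^T(\mathbf G^-)^T\mathbf Q_e\,\mathbf G^-\mathbf N$$ is a symmetric banded Toeplitz matrix with bandwidth $r=\max(\mu_u,\mu_e+\nu)$; that is, there are real numbers $a_0,\dots,a_r$ such that $\mathbf A_{ij}=a_{|i-j|}$ whenever $|i-j|\le r$ and $\mathbf A_{ij}=0$ whenever $|i-j|>r$.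
   Context: Definitions of the matrices (indices start at 1): - $\mathbf G^-$ is the $(n+2\nu)\times(n+2\nu)$ lower triangular banded Toeplitz matrix with $\mathbf G^-_{ij}=g_{i-j}$ if $0\le i-j\le\nu$ and $\mathbf G^-_{ij}=0$ otherwise. - $\mathbf Q_u$ is the $n\times n$ matrix with $(\mathbf Q_u)_{ij}=q^u_{|i-j|}$ if $|i-j|\le\mu_u$ and $0$ otherwise. - $\mathbf Q_e$ is the $(n+2\nu)\times(n+2\nu)$ matrix with $(\mathbf Q_e)_{ij}=q^e_{|i-j|}$ if $|i-j|\le\mu_e$ and $0$ otherwise. - $\mathbf N$ is the $(n+2\nu)\times n$ ''zero-padding'' matrix obtained by stacking the $\nu\times n$ zero matrix, the $n\times n$ identity matrix, and the $\nu\times n$ zero matrix; i.e. $\mathbf N_{ij}=1$ if $i=j+\nu$ and $0$ otherwise. *)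

(* Defs.v *)
From mathcomp Require Import all_boot all_order all_algebra reals.
Set Implicit Arguments.
Unset Strict Implicit.
Unset Printing Implicit Defensive.
Import Order.TTheory GRing.Theory Num.Theory.
Local Open Scope ring_scope.

(* Rows and columns are numbered from 0 by ['I_m]; the matrices below depend on
   the indices only through differences, so the entry formulas are the same as
   with numbering from 1.  Coefficient families [c_0, ..., c_mu] are functions
   on [nat] of which only the values at [0, ..., mu] are ever used. *)
Section Matrices.
Variable R : realType.

Definition Gminus (n nu : nat) (g : nat -> R) : 'M[R]_(n + 2 * nu) :=
  \matrix_(i, j) if (j <= i <= j + nu)%N then g (i - j)%N else 0.

(* Serves for both Q_u (m = n) and Q_e (m = n + 2 * nu). *)
Definition Qmx (m mu : nat) (q : nat -> R) : 'M[R]_m :=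
  \matrix_(i, j) if (`|i%:Z - j%:Z| <= mu)%N then q `|i%:Z - j%:Z|%N else 0.

Definition Nmx (n nu : nat) : 'M[R]_(n + 2 * nu, n) :=
  \matrix_(i, j) if i == (j + nu)%N :> nat then 1 else 0.

Definition Amx (n nu mu_u mu_e : nat) (alpha : R) (g qu qe : nat -> R) :
    'M[R]_n :=
  Qmx n mu_u qu
  - alpha *: ((Nmx n nu)^T *m (Gminus n nu g)^T *m Qmx (n + 2 * nu) mu_e qe
              *m Gminus n nu g *m Nmx n nu).

End Matrices.

Arguments Nmx {R} n nu.

(* Main.v *)
Require Import Defs.
From mathcomp Require Import all_boot all_order all_algebra reals.
From mathcomp Require Import zify ring.
Set Implicit Arguments.
Unset Strict Implicit.
Unset Printing Implicit Defensive.
Import Order.TTheory GRing.Theory Num.Theory.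
Local Open Scope ring_scope.

(** The zero padding gives every column of [G^- N] room for the whole filter
    [g_0, ..., g_nu]: column [j] is the filter placed at rows
    [j + nu, ..., j + 2 nu], and since [j < n] it is never cut off at the
    border ([sum_filter]).  The entry [(i, j)] of
    [(G^- N)^T Q_e (G^- N)] is therefore the complete double sum of
    [g_s g_t q^e_|(i + s) - (j + t)|], with no boundary correction, and depends
    on [i - j] only ([filtered_Qmx_entry]).  As a function of the integer
    [z = i - j], this sum is even, because exchanging [s] and [t] replaces [z]
    by [- z]; it vanishes for [|z| > mu_e + nu], because [|s - t| <= nu].  The
    entries [q^u_|i - j|] of [Q_u] are of the same kind with bandwidth [mu_u],
    and the difference of two even banded symbols is an even symbol whose
    bandwidth is at most the larger of the two. *)

Section BandedToeplitz.
Variable R : realType.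

(** Indexing by signed integers makes the shifts [z + s - t] below meaningful
    without case analysis on the sign. *)
Definition band_symbol (mu : nat) (q : nat -> R) (z : int) : R :=
  if (`|z| <= mu)%N then q `|z|%N else 0.

Definition filtered_symbol (nu mu : nat) (g q : nat -> R) (z : int) : R :=
  \sum_(s < nu.+1) \sum_(t < nu.+1)
    g s * g t * band_symbol mu q (z + s%:Z - t%:Z).

Lemma band_symbolN mu q z : band_symbol mu q (- z) = band_symbol mu q z.
Proof. by rewrite /band_symbol abszN. Qed.

Lemma band_symbol0 mu q z : (mu < `|z|)%N -> band_symbol mu q z = 0.
Proof. by rewrite /band_symbol ltnNge; case: leqP. Qed.

(** Negating the argument amounts to exchanging the roles of [s] and [t]. *)
Lemma filtered_symbolN nu mu g q z :
  filtered_symbol nu mu g q (- z) = filtered_symbol nu mu g q z.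
Proof.
rewrite /filtered_symbol exchange_big /=; apply: eq_bigr => t _.
apply: eq_bigr => s _; rewrite -band_symbolN [g s * g t]mulrC.
by congr (_ * band_symbol _ _ _); ring.
Qed.

(** The difference [s - t] of two filter positions is at most [nu] in absolute
    value, so filtering widens the band by at most [nu]. *)
Lemma filtered_symbol0 nu mu g q z :
  (mu + nu < `|z|)%N -> filtered_symbol nu mu g q z = 0.
Proof.
move=> hz; rewrite /filtered_symbol big1 // => s _; rewrite big1 // => t _.
rewrite band_symbol0 ?mulr0 //.
by have := ltn_ord s; have := ltn_ord t; lia.
Qed.

Lemma Gminus_Nmx_entry n nu (g : nat -> R) (k : 'I_(n + 2 * nu)) (j : 'I_n) :
  (Gminus n nu g *m Nmx n nu) k j =
  if (j + nu <= k <= j + nu + nu)%N then g (k - (j + nu))%N else 0.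
Proof.
have hj : (j + nu < n + 2 * nu)%N by have := ltn_ord j; lia.
rewrite mxE (bigD1 (Ordinal hj)) //= !mxE eqxx mulr1 big1 ?addr0 // => l hl.
by rewrite [X in _ * X]mxE ifN ?mulr0.
Qed.

(** Pairing with column [j] of [G^- N] is a sum over the whole filter: the
    bound [j + 2 nu < n + 2 nu] keeps its last row inside the matrix. *)
Lemma sum_filter n nu (g F : nat -> R) (j : 'I_n) :
  \sum_(k < n + 2 * nu) (Gminus n nu g *m Nmx n nu) k j * F k =
  \sum_(s < nu.+1) g s * F (j + nu + s)%N.
Proof.
under eq_bigr do rewrite Gminus_Nmx_entry.
pose E k := (if (j + nu <= k <= j + nu + nu)%N then g (k - (j + nu))%N else 0)
            * F k.
rewrite -(big_mkord xpredT E).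
have hj := ltn_ord j.
(* Rows outside [j + nu, ..., j + 2 nu] contribute nothing. *)
rewrite (@big_cat_nat _ _ _ (j + nu)) /=; [|lia|lia].
rewrite big_nat big1 ?add0r => [|k hk]; last first.
  by rewrite /E ifN ?mul0r //; lia.
rewrite (@big_cat_nat _ _ _ (j + nu + nu).+1) /=; [|lia|lia].
rewrite [X in _ + X]big_nat [X in _ + X]big1 ?addr0 => [|k hk]; last first.
  by rewrite /E ifN ?mul0r //; lia.
rewrite -{1}[(j + nu)%N]add0n big_addn.
have -> : ((j + nu + nu).+1 - (j + nu) = nu.+1)%N by lia.
rewrite big_mkord; apply: eq_bigr => s _; rewrite /E ifT; last first.
  by have := ltn_ord s; lia.
by rewrite addnK addnC.
Qed.

Lemma Qmx_entry m mu q (i j : 'I_m) :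
  Qmx m mu q i j = band_symbol mu q (i%:Z - j%:Z).
Proof. by rewrite mxE. Qed.

(** Both filters being complete, only the difference of their positions
    matters. *)
Lemma filtered_Qmx_entry n nu mu (g q : nat -> R) (i j : 'I_n) :
  ((Nmx n nu)^T *m (Gminus n nu g)^T *m Qmx (n + 2 * nu) mu q
   *m Gminus n nu g *m Nmx n nu) i j
  = filtered_symbol nu mu g q (i%:Z - j%:Z).
Proof.
rewrite -trmx_mul -mulmxA.
set B := Gminus n nu g *m Nmx n nu.
have BQ (l : 'I_(n + 2 * nu)) : (B^T *m Qmx _ mu q) i l =
    \sum_(s < nu.+1) g s * band_symbol mu q ((i + nu + s)%N%:Z - l%:Z).
  rewrite -(sum_filter nu g (fun k => band_symbol mu q (k%:Z - l%:Z))) mxE.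
  by apply: eq_bigr => k _; rewrite Qmx_entry mxE.
rewrite mxE.
under eq_bigr do rewrite BQ mulrC.
rewrite (sum_filter nu g (fun l => \sum_(s < nu.+1)
  g s * band_symbol mu q ((i + nu + s)%N%:Z - l%:Z))).
under eq_bigr do rewrite mulr_sumr.
rewrite exchange_big; apply: eq_bigr => s _; apply: eq_bigr => t _.
rewrite mulrA [g t * g s]mulrC; congr (_ * band_symbol _ _ _); lia.
Qed.

End BandedToeplitz.

Theorem theorem1 (R : realType) (n nu mu_u mu_e : nat) (hn : (1 <= n)%N)
    (alpha : R) (g qu qe : nat -> R)
    (hqu : \sum_(0 <= i < mu_u.+1) qu i = 1)
    (hqe : \sum_(0 <= i < mu_e.+1) qe i = 1) :
  let r := maxn mu_u (mu_e + nu) in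
  let A := Amx n nu mu_u mu_e alpha g qu qe in
  exists a : nat -> R, forall i j : 'I_n,
    ((`|i%:Z - j%:Z| <= r)%N -> A i j = a `|i%:Z - j%:Z|%N) /\
    ((r < `|i%:Z - j%:Z|)%N -> A i j = 0).
Proof.
move=> r A.
pose c z := band_symbol mu_u qu z - alpha * filtered_symbol nu mu_e g qe z.
have cN z : c (- z) = c z by rewrite /c band_symbolN filtered_symbolN.
have Aij i j : A i j = c (i%:Z - j%:Z).
  rewrite /A /Amx mxE Qmx_entry [X in _ + X]mxE [X in _ - X]mxE.
  by rewrite filtered_Qmx_entry.
exists (fun k => c k%:Z) => i j; rewrite Aij; split=> [_ | hr].
  by case: (intP (i%:Z - j%:Z)) => [|k|k] //; rewrite cN abszN.
move: hr; rewrite /r gtn_max => /andP[hu he].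
by rewrite /c band_symbol0 // filtered_symbol0 // mulr0 subr0.
Qed.
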